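(* Let $M,N$ be positive integers and $\lambda:=\frac MN$. The algorithm STC, run with all $N$ eigenvalues equal to $\lambda$, can be performed to generate a unit norm tight frame of $M$ vectors in $\mathbb R^N$ if and only if $\lambda\ge2$ or $\lambda$ is of the form $\lambda=\frac{2L-1}{L}$ for some positive integer $L$.
   Context: A sequence $(f_m)_{m=1}^M$ in $\mathbb R^N$ is a unit norm tight frame if $\|f_m\|=1$ for all $m$ and $FF^*=\frac MN I$, where $F$ is the $N\times M$ matrix with columns $f_1,\dots,f_M$. The STC (Spectral Tetris) algorithm, run on an ordered sequence $(\lambda_n)_{n=1}^N$ of positive reals with $\sum_{n=1}^N\lambda_n=M\in\mathbb N$. Let $(e_n)_{n=1}^N$ be the standard basis of $\mathbb R^N$. Keep residuals $r_1,\dots,r_N$, initially $r_n=\lambda_n$, and a counter $m$, initially $m=1$. For $n=1,\dots,N$ in this order, as long as $r_n>0$ repeat the following step. - If $r_n\ge1$: set $f_m=e_n$, replace $r_n$ by $r_n-1$, and $m$ by $m+1$. - If $r_n<1$: set $f_m=\sqrt{\frac{r_n}2}\,e_n+\sqrt{1-\frac{r_n}2}\,e_{n+1}$ and $f_{m+1}=\sqrt{\frac{r_n}2}\,e_n-\sqrt{1-\frac{r_n}2}\,e_{n+1}$, then replace $r_{n+1}$ by $r_{n+1}-(2-r_n)$, $r_n$ by $0$, and $m$ by $m+2$. The run is successful (''STC can be performed'') if $n+1\le N$ whenever $e_{n+1}$ is used and no residual ever becomes negative; the output is then $(f_m)_{m=1}^M$. *)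

(* Defs.v *)
From mathcomp Require Import all_boot all_order all_algebra.
From mathcomp Require Import reals.
Set Implicit Arguments.
Unset Strict Implicit.
Unset Printing Implicit Defensive.
Import Order.TTheory GRing.Theory Num.Theory.
Local Open Scope ring_scope.

(* Euclidean norm; the library's norm on matrices is the sup norm. *)
Definition euclidean_norm (R : realType) (N : nat) (x : 'cV[R]_N) : R :=
  Num.sqrt (\sum_(i < N) x i 0 ^+ 2).

(* A sequence of M vectors of R^N is given by the matrix F having them as
   columns; over the reals the adjoint F^* is the transpose. *)
Definition unit_norm_tight_frame (R : realType) (N M : nat)
    (F : 'M[R]_(N, M)) : Prop :=
  (forall m : 'I_M, euclidean_norm (col m F) = 1) /\
  F *m F^T = (M%:R / N%:R)%:M.

(* Indices are 0-based. The value N of [stc_cur] means that the loop over n is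
   over. The counter m is left implicit: in 1-based numbering it is
   (size stc_out).+1, new vectors being appended at the end of stc_out. *)
Record stc_state (R : realType) (N : nat) := StcState {
  stc_cur : nat;
  stc_res : 'I_N -> R;
  stc_out : seq 'cV[R]_N
}.

Definition basis_vector (R : realType) (N : nat) (n : 'I_N) : 'cV[R]_N :=
  delta_mx n 0.

(* In [stc_pair] the index n' is n + 1; since n' : 'I_N, no step is possible
   when e_(n+1) does not exist. *)
Inductive stc_step (R : realType) (N : nat) :
    stc_state R N -> stc_state R N -> Prop :=
| stc_advance (n : 'I_N) (r : 'I_N -> R) (fs : seq 'cV[R]_N) :
    ~~ (0 < r n) ->
    stc_step (StcState n r fs) (StcState n.+1 r fs)
| stc_single (n : 'I_N) (r : 'I_N -> R) (fs : seq 'cV[R]_N) :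
    0 < r n -> 1 <= r n ->
    stc_step (StcState n r fs)
      (StcState n [eta r with n |-> r n - 1] (rcons fs (basis_vector R n)))
| stc_pair (n n' : 'I_N) (r : 'I_N -> R) (fs : seq 'cV[R]_N) :
    n' = n.+1 :> nat ->
    0 < r n -> r n < 1 ->
    let u := Num.sqrt (r n / 2) *: basis_vector R n in
    let v := Num.sqrt (1 - r n / 2) *: basis_vector R n' in
    stc_step (StcState n r fs)
      (StcState n [eta r with n |-> 0, n' |-> r n' - (2 - r n)]
        (fs ++ [:: u + v; u - v])).

(* The states that a run on the eigenvalues lambda goes through as long as no
   residual has become negative. *)
Inductive stc_reachable (R : realType) (N : nat) (lambda : 'I_N -> R) :
    stc_state R N -> Prop :=
| stc_start : stc_reachable lambda (StcState 0 lambda [::])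
| stc_continue (s s' : stc_state R N) :
    stc_reachable lambda s -> stc_step s s' ->
    (forall n : 'I_N, 0 <= stc_res s' n) ->
    stc_reachable lambda s'.

(* The run on lambda is successful, and outputs the columns of F in order.
   Steps are deterministic, so a successful run is one reaching the end of the
   loop over n. *)
Definition stc_outputs (R : realType) (N M : nat) (lambda : 'I_N -> R)
    (F : 'M[R]_(N, M)) : Prop :=
  exists s : stc_state R N,
    [/\ stc_reachable lambda s, stc_cur s = N
      & stc_out s = [seq col m F | m <- enum 'I_M]].

(* Main.v *)
Require Import Defs.
From mathcomp Require Import all_boot all_order all_algebra.
From mathcomp Require Import boolp reals.
From mathcomp Require Import zify ring lra.
Import Order.TTheory GRing.Theory Num.Theory.
Local Open Scope ring_scope.

(* Every state of a run satisfies the frame identity "sum of f f^T over the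
   vectors produced so far + diag(residuals) = diag(lambda)", so a run that
   reaches the end outputs a tight frame, and taking traces shows that the
   residuals always add up to an integer.  Hence the last residual cannot lie
   strictly between 0 and 1, and the only possible failure is a residual
   lambda - (2 - r) < 0 after a pair.  For lambda >= 2 this never happens.  For
   lambda < 2 the current residual is lambda at first and then runs through
   1 - k (2 - lambda), k = 1, 2, ...; unless this sequence hits 0 exactly, i.e.
   lambda = 2 - 1/k, a positive residual remains as long as none is negative,
   so the run cannot end, whereas after hitting 0 it starts afresh with residual
   lambda. *)

(* inv_next requires a positive current residual because right after a pair the
   residual of the next index has already been lowered. *)
Record stc_invariant {R : realType} {N : nat} (lambda : 'I_N -> R)
    (s : stc_state R N) : Prop := StcInvariant {
  inv_cur : (stc_cur s <= N)%N;
  inv_ge0 : forall i, 0 <= stc_res s i;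
  inv_past : forall i : 'I_N, (i < stc_cur s)%N -> stc_res s i = 0;
  inv_next : forall n i : 'I_N, n = stc_cur s :> nat -> 0 < stc_res s n ->
    (n < i)%N -> stc_res s i = lambda i;
  inv_future : forall i : 'I_N, ((stc_cur s).+1 < i)%N ->
    stc_res s i = lambda i;
  inv_norm : forall f, f \in stc_out s -> \sum_i f i 0 ^+ 2 = 1;
  inv_frame : forall i j, \sum_(f <- stc_out s) f i 0 * f j 0 =
    (lambda i - stc_res s i) *+ (i == j)
}.
Arguments inv_cur {R N lambda s}.
Arguments inv_ge0 {R N lambda s}.
Arguments inv_past {R N lambda s}.
Arguments inv_next {R N lambda s}.
Arguments inv_future {R N lambda s}.
Arguments inv_norm {R N lambda s}.
Arguments inv_frame {R N lambda s}.

(** * Frame identity and trace identity for arbitrary eigenvalues *)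

Section Reachable.
Context {R : realType} {N : nat}.
Implicit Types (lambda : 'I_N -> R) (s : stc_state R N).

Lemma sum_basis_vector (n : 'I_N) : \sum_i basis_vector R n i 0 = 1.
Proof.
rewrite (bigD1 n) //= big1 ?addr0 => [|i /negPf ni]; rewrite mxE ?eqxx ?ni //.
Qed.

Lemma basis_vector_combination_norm (n n' : 'I_N) (a b : R) : n != n' ->
  \sum_i (a *: basis_vector R n + b *: basis_vector R n') i 0 ^+ 2 =
  a ^+ 2 + b ^+ 2.
Proof.
move=> nn'; transitivity (\sum_i (a ^+ 2 * basis_vector R n i 0
                               + b ^+ 2 * basis_vector R n' i 0)).
  apply: eq_bigr => i _; rewrite !mxE !andbT.
  have [->|_] := eqVneq i n; first by rewrite (negPf nn') /=; ring.
  by case: eqP => _ /=; ring.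
by rewrite big_split /= -!mulr_sumr !sum_basis_vector !mulr1.
Qed.

Lemma stc_step_invariant lambda s s' : stc_invariant lambda s ->
  stc_step s s' -> (forall i, 0 <= stc_res s' i) -> stc_invariant lambda s'.
Proof.
move=> inv step; case: step inv => {s s'}
    [n r fs rn|n r fs r0 r1|n n' r fs n'E r0 r1 u v]
    [/= cN ge0 past next future norms frame] ge0'; split=> //=.
- move=> i; rewrite ltnS leq_eqVlt => /orP[/eqP/val_inj ->|/past //].
  by apply/eqP; rewrite eq_le ge0 leNgt rn.
- by move=> m i mE _ mi; apply: future; lia.
- by move=> i ni; apply: future; lia.
- move=> i ni; have [iE|_] := eqVneq i n; last exact: past.
  by move: ni; rewrite iE ltnn.
- move=> m i mE _ mi; have [iE|_] := eqVneq i n; first by move: mi; rewrite iE; lia.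
  by apply: (next n i) => //; lia.
- move=> i ni; have [iE|_] := eqVneq i n; first by move: ni; rewrite iE; lia.
  exact: future.
- move=> f; rewrite mem_rcons inE => /orP[/eqP ->|/norms //].
  rewrite -(sum_basis_vector n); apply: eq_bigr => i _.
  by rewrite !mxE andbT; case: eqP => _ /=; ring.
- move=> i j; rewrite big_rcons /= frame !mxE !andbT.
  have [->|ni] := eqVneq i n; last by rewrite mul0r ?add0r ?addr0.
  by rewrite eq_sym; case: eqP => _ /=; ring.
- move=> i ni; have [//|_] := eqVneq i n.
  have [iE|_] := eqVneq i n'; last exact: past.
  by move: ni; rewrite iE n'E; lia.
- by move=> m i /val_inj ->; rewrite eqxx ltxx.
- move=> i ni; have [iE|_] := eqVneq i n; first by move: ni; rewrite iE; lia.
  have [iE|_] := eqVneq i n'; first by move: ni; rewrite iE; lia.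
  exact: future.
- have nn' : n != n' by apply/eqP => nE; move: n'E; rewrite nE; lia.
  have r2 : 0 <= r n / 2 by lra.
  have s2 : 0 <= 1 - r n / 2 by lra.
  move=> f; rewrite mem_cat !inE => /or3P[/norms //|/eqP ->|/eqP ->].
    by rewrite basis_vector_combination_norm // !sqr_sqrtr //; ring.
  rewrite /u /v -scaleNr basis_vector_combination_norm // sqrrN.
  by rewrite !sqr_sqrtr //; ring.
- have nn' : n != n' by apply/eqP => nE; move: n'E; rewrite nE; lia.
  have r2 : 0 <= r n / 2 by lra.
  have s2 : 0 <= 1 - r n / 2 by lra.
  have lE : r n' = lambda n' by apply: (next n) => //; rewrite n'E.
  move=> i j; rewrite big_cat !big_cons big_nil /= frame !mxE !andbT.
  have := sqr_sqrtr r2; have := sqr_sqrtr s2.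
  (* Only the squares of the two roots matter: the mixed entries at [n], [n'] cancel between [u + v]
     and [u - v], and the diagonal gains are [r n] and [2 - r n]. *)
  move: (Num.sqrt _) (Num.sqrt _) => b a bE aE.
  have [iE|ni] := eqVneq i n; have [jE|nj] := eqVneq j n;
    have [iE'|ni'] := eqVneq i n'; have [jE'|nj'] := eqVneq j n';
    have [ijE|nij] := eqVneq i j; subst => //=; try by rewrite eqxx in nn'.
  all: try by rewrite eqxx in nij.
  all: try by rewrite eqxx in nj.
  all: try by rewrite eqxx in nj'.
  all: rewrite ?mulr1n ?mulr0n.
  all: nra.
Qed.

Lemma stc_reachable_invariant lambda s : (forall i, 0 <= lambda i) ->
  stc_reachable lambda s -> stc_invariant lambda s.
Proof.
move=> lambda0; elim=> [|{}s s' _ IH step ge0]; last exact: stc_step_invariant step ge0.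
split=> //= i j; by rewrite big_nil subrr mul0rn.
Qed.

(** This is the trace of the frame identity, each unit vector contributing 1. *)
Lemma sum_residuals {lambda s} : stc_invariant lambda s ->
  \sum_i stc_res s i = \sum_i lambda i - (size (stc_out s))%:R.
Proof.
move=> inv; have: \sum_i (lambda i - stc_res s i) = (size (stc_out s))%:R.
  transitivity (\sum_i \sum_(f <- stc_out s) f i 0 ^+ 2).
    by apply: eq_bigr => i _; have := inv_frame inv i i; rewrite eqxx mulr1n => <-.
  rewrite exchange_big /= big_seq (eq_bigr (fun=> 1)).
    by rewrite -big_seq big_const_seq count_predT iter_addr_0.
  by move=> f /(inv_norm inv).
by rewrite sumrB => <-; ring.
Qed.

End Reachable.

(** * Residuals that occur when all eigenvalues are equal *)

(** The clauses follow a fresh index, a single vector, and the residual that a pair leaves at the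
    next index. No sign is imposed on the latter, so [G] may also contain the negative values at
    which a run fails. *)
Definition stc_closed {R : realType} (lambda : R) (G : R -> Prop) : Prop :=
  [/\ G lambda, forall r, G r -> 1 <= r -> G (r - 1)
    & forall r, G r -> 0 < r -> r < 1 -> G (lambda - (2 - r))].

Section ConstantEigenvalue.
Context {R : realType} {N : nat} {lambda : R} {G : R -> Prop}.
Hypotheses (lambda0 : 0 < lambda) (closedG : stc_closed lambda G).
Implicit Type s : stc_state R N.

Let constant_invariant {s} : stc_reachable (fun=> lambda) s ->
  stc_invariant (fun=> lambda) s.
Proof. by apply: stc_reachable_invariant => _; exact: ltW. Qed.

(** Restricted to positive residuals because a pair resets its own index to 0, a value that [G] may
    omit. *)
Lemma stc_reachable_closed {s} : stc_reachable (fun=> lambda) s ->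
  forall i, 0 < stc_res s i -> G (stc_res s i).
Proof.
case: closedG => Gl G1 G2.
elim=> [//|{}s s' /constant_invariant inv IH step _].
case: step inv IH => {s s'} [n r fs rn|n r fs r0 r1|n n' r fs n'E r0 r1 u v]
    inv IH i //=.
- exact: IH.
- have [_ _|_] := eqVneq i n; last exact: IH.
  by apply: G1 => //; exact: IH.
- have [_|_] := eqVneq i n; first by rewrite ltxx.
  have [_ _|_] := eqVneq i n'; last exact: IH.
  have -> : r n' = lambda by apply: (inv_next inv n n') => //; rewrite n'E.
  by apply: G2 => //; exact: IH.
Qed.

(** Used to show that a run cannot end. A residual lowered exactly to 0 by a single vector, or at
    the next index by a pair, would put 0 into [G]; and advancing never passes a positive
    residual. *)
Lemma stc_residual_remains {s} : (0 < N)%N -> ~ G 0 ->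
  stc_reachable (fun=> lambda) s ->
  exists2 i : 'I_N, (stc_cur s <= i)%N & 0 < stc_res s i.
Proof.
move=> N0 G0; elim=> [|{}s s' reach IH step ge0].
  by exists (Ordinal N0).
have inv := constant_invariant reach.
have closed := stc_reachable_closed reach.
case: closedG => _ G1 G2.
case: step IH ge0 inv closed {reach} => {s s'}
    [n r fs rn|n r fs r0 r1|n n' r fs n'E r0 r1 u v] IH ge0 inv closed.
- case: IH => i /= ni ri; exists i => //; rewrite ltn_neqAle ni andbT.
  by apply: contraNneq rn => /val_inj ->.
- exists n => //=; have := ge0 n; rewrite /= eqxx le_eqVlt => /predU1P[E|//].
  by case: G0; rewrite E; apply: G1 => //; exact: closed.
- have nn' : n' != n by apply/eqP => nE; move: n'E; rewrite nE; lia.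
  exists n' => /=; first by rewrite n'E.
  have := ge0 n'; rewrite /= (negPf nn') eqxx le_eqVlt => /predU1P[E|//].
  have lE : r n' = lambda by apply: (inv_next inv n n') => //; rewrite n'E.
  case: G0; rewrite E lE.
  by apply: G2 => //; exact: closed.
Qed.

Lemma stc_run_exists {M : nat} : N%:R * lambda = M%:R ->
  (forall r, G r -> 0 <= r) ->
  exists s, stc_reachable (N := N) (fun=> lambda) s /\ stc_cur s = N.
Proof.
move=> NM G0.
have sumN : \sum_(i < N) lambda = M%:R by rewrite sumr_const card_ord -NM mulr_natl.
have size_le s : stc_reachable (fun=> lambda) s -> (size (stc_out s) <= M)%N.
  move=> /constant_invariant inv; rewrite -(ler_nat R) -subr_ge0 -sumN.
  by rewrite -(sum_residuals inv) sumr_ge0 // => i _; exact: inv_ge0 inv _.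
(* Each step advances the index or appends vectors, and both are bounded, so it suffices that no
   state before the end is stuck. *)
suff run k s : stc_reachable (fun=> lambda) s ->
    (N - stc_cur s + (M - size (stc_out s)) <= k)%N ->
    exists s', stc_reachable (N := N) (fun=> lambda) s' /\ stc_cur s' = N.
  exact: (run _ _ (stc_start _) (leqnn _)).
elim: k s => [|k IH] s reach le_k; have inv := constant_invariant reach.
  by exists s; split=> //; have := inv_cur inv; lia.
have [|cN] := leqP N (stc_cur s).
  by move=> Nc; exists s; split=> //; have := inv_cur inv; lia.
suff [s' [step ge0 lt_s]] : exists s', [/\ stc_step s s',
    forall i, 0 <= stc_res s' i
  & (stc_cur s + size (stc_out s) < stc_cur s' + size (stc_out s'))%N].
  have reach' := stc_continue reach step ge0.
  apply: (IH s' reach'); have := inv_cur (constant_invariant reach').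
  by have := size_le _ reach'; have := size_le _ reach; lia.
have closed := stc_reachable_closed reach.
have sums := sum_residuals inv; have sM := size_le _ reach.
case: closedG => _ G1 G2.
case: s {reach IH le_k} cN closed inv sums sM => c r fs /= cN closed inv sums sM.
have [ge0 past] := (inv_ge0 inv, inv_past inv); rewrite /= in ge0 past.
have [n nE] : exists n : 'I_N, n = c :> nat by exists (Ordinal cN).
subst c.
have [r0|rn] := ltP 0 (r n); last first.
  exists (StcState n.+1 r fs); split=> //=.
  by apply: stc_advance; rewrite -leNgt.
have [r1|r1] := leP 1 (r n).
  eexists; split; first exact: stc_single.
  - by move=> i /=; case: eqP => // _; rewrite subr_ge0.
  - by rewrite /= size_rcons; lia.
have [n1N|Nn1] := ltnP n.+1 N.
  pose n' := Ordinal n1N.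
  eexists; split; first exact: (@stc_pair _ _ n n').
  - move=> i /=; have [//|_] := eqVneq i n; have [_|//] := eqVneq i n'.
    have -> : r n' = lambda by apply: (inv_next inv n n').
    by apply: G0; apply: G2 => //; exact: closed.
  - by rewrite /= size_cat /=; lia.
(* A pair is due at the last index. All earlier residuals vanish, so this one is an integer strictly
   between 0 and 1, a contradiction. *)
have rnE : r n = (M - size fs)%:R.
  rewrite natrB // -sumN -sums (bigD1 n) //= big1 ?addr0 // => i ni.
  apply: past; rewrite ltn_neqAle.
  by have := ltn_ord i; move: ni; rewrite -(inj_eq val_inj) /=; lia.
by move: r0 r1; rewrite rnE ltr0n (ltr_nat R _ 1); lia.
Qed.

End ConstantEigenvalue.

(* "STC can be performed" is just termination: the output is then automatically
   a unit norm tight frame of the right size. *)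
Lemma stc_run_tight_frame {R : realType} (M N : nat) (s : stc_state R N) :
  (0 < N)%N -> let lambda : R := M%:R / N%:R in
  stc_reachable (fun=> lambda) s -> stc_cur s = N ->
  exists F : 'M[R]_(N, M),
    stc_outputs (fun=> lambda) F /\ unit_norm_tight_frame F.
Proof.
move=> N0 lambda reach sN.
have N0' : N%:R != 0 :> R by rewrite pnatr_eq0; lia.
have inv : stc_invariant (fun=> lambda) s.
  by apply: stc_reachable_invariant reach => _; exact: divr_ge0.
have res0 i : stc_res s i = 0 by apply: (inv_past inv); rewrite sN.
(* With all residuals zero, the trace identity makes the number of vectors equal to the sum of the
   eigenvalues. *)
have sizeM : size (stc_out s) = M.
  apply/eqP; rewrite -(eqr_nat R); apply/eqP.
  have := sum_residuals inv; rewrite (eq_bigr (fun=> 0)) // sumr_const mul0rn.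
  move/esym/subr0_eq => <-.
  by rewrite sumr_const card_ord -[_ *+ N]mulr_natr /lambda divfK.
pose F : 'M[R]_(N, M) := \matrix_(i, j) (nth 0 (stc_out s) j) i 0.
have colF j : col j F = nth 0 (stc_out s) j.
  by apply/matrixP => i k; rewrite !mxE (ord1 k).
have outE : stc_out s = [seq col m F | m <- enum 'I_M].
  apply: (@eq_from_nth _ 0); first by rewrite size_map size_enum_ord.
  move=> i; rewrite sizeM => iM.
  by rewrite (nth_map (Ordinal iM)) ?size_enum_ord // colF nth_enum_ord.
exists F; split; first by exists s.
split=> [m|].
  rewrite /euclidean_norm colF (inv_norm inv) ?sqrtr1 //.
  by apply: mem_nth; rewrite sizeM.
apply/matrixP => i j; rewrite !mxE.
have := inv_frame inv i j; rewrite res0 subr0 => <-.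
rewrite outE big_map big_enum /=; apply: eq_bigr => m _.
by rewrite !mxE.
Qed.

(** * Choice of the residual set in each direction *)

Theorem theorem4p2 (R : realType) (M N : nat) (hM : (0 < M)%N) (hN : (0 < N)%N) :
  let lambda : R := M%:R / N%:R in
  (exists F : 'M[R]_(N, M),
      stc_outputs (fun _ : 'I_N => lambda) F /\ unit_norm_tight_frame F) <->
  (2 <= lambda \/
   exists L : nat, (0 < L)%N /\ lambda = (2 * L%:R - 1) / L%:R).
Proof.
move=> lambda.
have lambda0 : 0 < lambda by rewrite divr_gt0 // ltr0n.
have NM : N%:R * lambda = M%:R.
  by rewrite mulrC divfK // pnatr_eq0; lia.
split=> [[F [[s [reach sN _]] _]]|cases].
  have [|lt2] := leP 2 lambda; [by left|right].
  apply: contrapT => noL.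
  (* The alternative [r < 0] serves [lambda < 1], where the very first pair leaves [2 * lambda - 2]
     at the next index. *)
  pose G (r : R) := [\/ r = lambda, exists2 k : nat, (0 < k)%N &
    r = 1 - k%:R * (2 - lambda) | r < 0].
  have k_pos (k : nat) : (0 < k)%N -> 0 < k%:R * (2 - lambda).
    by move=> k0; rewrite mulr_gt0 ?ltr0n // subr_gt0.
  have closedG : stc_closed lambda G.
    split=> [|r Gr r1|r Gr r0 r1]; first by constructor 1.
      case: Gr => [->|[k /k_pos k0 rE]|rn]; [|exfalso; lra|exfalso; lra].
      by constructor 2; exists 1%N => //; ring.
    case: Gr => [rE|[k k0 ->]|rn]; [by constructor 3; lra| |exfalso; lra].
    by constructor 2; exists k.+1 => //; rewrite -natr1; ring.
  have G0 : ~ G 0.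
    case=> [E|[k k0 E]|]; [lra| |by rewrite ltxx].
    case: noL; exists k; split=> //.
    have k0' : k%:R != 0 :> R by rewrite pnatr_eq0; lia.
    by apply: (mulIf k0'); rewrite divfK //; lra.
  have [i] := stc_residual_remains lambda0 closedG hN G0 reach.
  by rewrite sN leqNgt ltn_ord.
suff [G closedG Gge0] : exists2 G, stc_closed lambda G & forall r, G r -> 0 <= r.
  have [s [reach sN]] := stc_run_exists lambda0 closedG NM Gge0.
  exact: stc_run_tight_frame hN reach sN.
case: cases => [ge2|[L [L0 lE]]].
  by exists (fun r => 0 <= r) => //; split=> *; lra.
have L0' : 0 < L%:R :> R by rewrite ltr0n.
have {}lE : lambda = 2 - L%:R^-1 by rewrite lE; field; rewrite gt_eqF.
have iL : 0 < L%:R^-1 :> R by rewrite invr_gt0.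
have iL1 : L%:R^-1 <= 1 :> R by rewrite invf_le1 // ler1n.
have LiL : L%:R * L%:R^-1 = 1 :> R by rewrite divff // gt_eqF.
(* Now [2 - lambda] is [1 / L], so the progression reaches 0 exactly at [k = L]. A pair starts from
   a positive residual, hence from [k < L], and the bound on [k] is preserved. *)
exists (fun r => r = lambda \/ exists2 k : nat, (0 < k <= L)%N &
    r = 1 - k%:R * L%:R^-1); last first.
  move=> r [->|[k /andP[_ kL] ->]]; first exact: ltW.
  by rewrite subr_ge0 -[leRHS]LiL ler_pM2r // ler_nat.
split=> [|r Gr r1|r Gr r0 r1]; first by left.
- case: Gr => [->|[k /andP[k0 _] rE]].
    by right; exists 1%N; [lia|rewrite lE; ring].
  have kL0 : 0 < k%:R * L%:R^-1 :> R by rewrite mulr_gt0 ?ltr0n.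
  by exfalso; lra.
- case: Gr => [rE|[k /andP[k0 kL] rE]]; first by exfalso; lra.
  right; exists k.+1; last by rewrite rE lE -natr1; ring.
  rewrite /= -(ltr_nat R) -(ltr_pM2r iL) LiL.
  by lra.
Qed.
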